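(* Let $(A,\succ,\prec)$ be a Leibniz-dendriform algebra, $(B=\bigoplus_{i\in\mathbb Z}B_i,\diamond,\omega)$ a quadratic $\mathbb Z$-graded Zinbiel algebra, and $(A\otimes B,\cdot)$ the $\mathbb Z$-graded pre-Lie algebra with $$(a\otimes x)\cdot(b\otimes y)=(a\succ b)\otimes (x\diamond y)-(b\prec a)\otimes (y\diamond x).$$ Let $\{e_j\}_{j\in\Omega}$ be a homogeneous basis of $B$ and $\{f_j\}_{j\in\Omega}$ its homogeneous dual basis with respect to $\omega$. Suppose that $r=\sum_iu_i\otimes v_i\in A\otimes A$ is a solution of the LD-YBE in $(A,\succ,\prec)$ such that $r+\tau(r)$ is invariant in $A\otimes A$. Then $$\hat r=\sum_i\sum_{j\in\Omega}(u_i\otimes e_j)\otimes(v_i\otimes f_j)\in(A\otimes B)\hat\otimes(A\otimes B)$$ is a completed solution of the $S$-equation in $(A\otimes B,\cdot)$, and $\hat r-\hat\tau(\hat r)$ is invariant in $(A\otimes B)\hat\otimes(A\otimes B)$. In particular, if $r$ is a skew-symmetric solution of the LD-YBE in $(A,\succ,\prec)$, then $\hat r$ is a symmetric completed solution of the $S$-equation in $(A\otimes B,\cdot)$.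
   Context: All vector spaces are over a field $\mathbb K$; $\tau$ is the flip, $I$ the identity. Algebras are finite-dimensional except $\mathbb Z$-graded ones. For a bilinear operation $\ast$, $L_\ast(a)b=a\ast b$, $R_\ast(a)b=b\ast a$. Completed tensor products: for $\mathbb Z$-graded $U=\bigoplus U_i$, $V=\bigoplus V_j$, $U\hat\otimes V:=\prod_{i,j}U_i\otimes V_j$ (similarly for three factors); linear maps and the flip ($\hat\tau$) are extended termwise to formal sums. $A$ is in degree $0$ and $A\otimes B=\bigoplus_iA\otimes B_i$. Leibniz-dendriform algebra: bilinear $\succ,\prec$ such that, with $x\circ y=x\succ y+x\prec y$: $(x\circ y)\succ z=x\succ(y\succ z)-y\succ(x\succ z)$; $y\prec(x\circ z)+(x\succ y)\prec z=x\succ(y\prec z)$; $x\prec(y\circ z)=(x\prec y)\prec z+y\succ(x\prec z)$. Put $x\odot y=x\succ y+y\prec x$, $L_\odot=L_\succ+R_\prec$, $L_\star=L_\circ+R_\circ$. LD-YBE: for $r=\sum_iu_i\otimes v_i\in A\otimes A$, $r_{23}\circ r_{13}-r_{12}\odot r_{23}-r_{12}\succ r_{13}=0$, i.e. $\sum_{i,j}\big(u_j\otimes u_i\otimes (v_i\circ v_j)-u_i\otimes(v_i\odot u_j)\otimes v_j-(u_i\succ u_j)\otimes v_i\otimes v_j\big)=0$. An element $s\in A\otimes A$ is invariant if for all $x\in A$: $(L_\odot(x)\otimes I-I\otimes R_\circ(x))s=0$ and $(L_\star(x)\otimes I-I\otimes R_\prec(x))\tau(s)=0$. Quadratic $\mathbb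 Z$-graded Zinbiel algebra $(B=\bigoplus B_i,\diamond,\omega)$: each $B_i$ is finite-dimensional, $B_i\diamond B_j\subseteq B_{i+j}$, $x\diamond(y\diamond z)=(x\diamond y)\diamond z+(y\diamond x)\diamond z$, and $\omega$ is a non-degenerate skew-symmetric bilinear form, invariant ($\omega(x\diamond y,z)=\omega(y,x\diamond z+z\diamond x)$) and graded (there is $m\in\mathbb Z$ with $\omega(B_i,B_j)=0$ whenever $i+j+m\neq0$). The dual basis is normalized by $\omega(e_i,f_j)=\delta_{ij}$. Pre-Lie algebra $(L,\cdot)$: $(x\cdot y)\cdot z-x\cdot(y\cdot z)=(y\cdot x)\cdot z-y\cdot(x\cdot z)$; $[x,y]=x\cdot y-y\cdot x$. For a $\mathbb Z$-graded pre-Lie algebra $L$, $\hat r=\sum_i a_i\otimes b_i\in L\hat\otimes L$ is a completed solution of the $S$-equation if $\hat r_{12}\cdot\hat r_{13}-\hat r_{12}\cdot\hat r_{23}-[\hat r_{13},\hat r_{23}]=0$, i.e. $\sum_{i,j}\big((a_i\cdot a_j)\otimes b_i\otimes b_j-a_i\otimes(b_i\cdot a_j)\otimes b_j-a_i\otimes a_j\otimes[b_i,b_j]\big)=0$ in $L\hat\otimes L\hat\otimes L$. An element $\hat s\in L\hat\otimes L$ is invariant if $\big(L_\cdot(x)\hat\otimes I+I\hat\otimes(L_\cdot(x)-R_\cdot(x))\big)\hat s=0$ for all $x\in L$. *)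

(* Defs.v *)
From HB Require Import structures.
From mathcomp Require Import all_boot all_order all_algebra.
From mathcomp Require Import boolp classical_sets functions cardinality fsbigop.

Set Implicit Arguments.
Unset Strict Implicit.
Unset Printing Implicit Defensive.

Import GRing.Theory.

Local Open Scope classical_set_scope.
Local Open Scope ring_scope.

(** For finite-dimensional [U], [U ⊗ V] is modelled as [V ^ dim U]: with [b] the chosen basis of [U], the
    tensor [\sum_k b_k ⊗ w_k] is the family [(w_k)_k].  The right factor may be
    infinite-dimensional.  [tlift_pure] and [tens_ind] are the universal
    property, so nothing depends on the choice of basis. *)

Notation tens U V := {ffun 'I_(\dim {:U}%VS) -> V}.

Definition tpure (K : fieldType) (U : vectType K) (V : lmodType K)
    (u : U) (v : V) : tens U V :=
  [ffun k => coord (vbasis {:U}%VS) k u *: v].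

Notation "u '⊗' v" := (tpure u v) (at level 40, left associativity).

(* The linear map on [U ⊗ V] sending [u ⊗ v] to [beta u v], for [beta]
   bilinear. *)
Definition tlift (K : fieldType) (U : vectType K) (V W : lmodType K)
    (beta : U -> V -> W) (t : tens U V) : W :=
  \sum_(k < \dim {:U}%VS) beta (vbasis {:U}%VS)`_k (t k).

Definition tmap (K : fieldType) (U U' : vectType K) (V V' : lmodType K)
    (phi : U -> U') (psi : V -> V') (t : tens U V) : tens U' V' :=
  tlift (fun u v => phi u ⊗ psi v) t.

Definition tflip (K : fieldType) (U V : vectType K) (t : tens U V) :
    tens V U :=
  tlift (fun u v => v ⊗ u) t.

Section TensorTheory.
Context {K : fieldType} {U : vectType K} {V W : lmodType K}.
Implicit Types (u : U) (v : V) (s t : tens U V).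

Lemma tpure_bilinear : bilinear_for *:%R *:%R (@tpure K U V).
Proof.
split=> [v a u u' | u a v v']; apply/ffunP=> k; rewrite !ffunE.
  by rewrite linearP scalerDl scalerA.
by rewrite scalerDr !scalerA mulrC.
Qed.

HB.instance Definition _ :=
  bilinear_isBilinear.Build K U V (tens U V) _ _ (@tpure K U V) tpure_bilinear.

Lemma tens_sum t : t = \sum_(k < \dim {:U}%VS) (vbasis {:U}%VS)`_k ⊗ t k.
Proof.
apply/ffunP=> l; rewrite sum_ffunE (bigD1 l) //= ffunE.
rewrite coord_free ?(basis_free (vbasisP _)) // eqxx scale1r big1 ?addr0 //.
move=> k kl; rewrite ffunE coord_free ?(basis_free (vbasisP _)) //.
by rewrite (negPf kl) scale0r.
Qed.

Lemma tens_ind (P : tens U V -> Prop) :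
  P 0 -> (forall s t, P s -> P t -> P (s + t)) -> (forall u v, P (u ⊗ v)) ->
  forall t, P t.
Proof. by move=> P0 PD Ppure t; rewrite [t]tens_sum; elim/big_ind: _. Qed.

Lemma tlift_pure (beta : U -> V -> W) u v :
  bilinear_for *:%R *:%R beta -> tlift beta (u ⊗ v) = beta u v.
Proof.
case=> blin1 blin2.
have blin2Z a u' w : beta u' (a *: w) = a *: beta u' w.
  exact: (scalable_linear (blin2 u')).
have bl0 w : beta 0 w = 0.
  by have := blin1 w (-1) 0 0; rewrite /= scaler0 addr0 scaleN1r addNr.
rewrite {2}(coord_vbasis (memvf u)) /tlift.
under eq_bigr do rewrite ffunE blin2Z.
elim/big_rec2: _ => [|k y1 y2 _ ->]; first by rewrite bl0.
by rewrite [RHS]blin1.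
Qed.

End TensorTheory.

Lemma tlift_is_linear (K : fieldType) (U : vectType K) (V W : lmodType K)
    (beta : U -> V -> W) :
  (forall u, linear (beta u)) -> linear (tlift beta).
Proof.
move=> blin a s t; rewrite /tlift scaler_sumr -big_split /=.
by apply: eq_bigr => k _; rewrite !ffunE blin.
Qed.

(** A [Z]-grading with finite-dimensional components: [V] is the internal direct sum of the [zcomp i]; [zinj i] is the inclusion
    and [zproj i] the projection. *)

Record zgrading (K : fieldType) (V : lmodType K) := ZGrading {
  zcomp : int -> vectType K;
  zinj : forall i, {linear zcomp i -> V};
  zproj : forall i, {linear V -> zcomp i};
  zinjK : forall i x, zproj i (zinj i x) = x;
  zproj_neq : forall i j x, i != j -> zproj j (zinj i x) = 0;
  zdecomp : forall v, exists2 s : seq int,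
    uniq s & v = \sum_(i <- s) zinj i (zproj i v)
}.

Definition homogeneous (K : fieldType) (V : lmodType K) (g : zgrading V)
    (v : V) : Prop :=
  exists (i : int) (x : zcomp g i), v = zinj g i x.

Section TensorGrading.
Variables (K : fieldType) (U : vectType K) (V : lmodType K) (g : zgrading V).

Definition tcomp (i : int) : vectType K := tens U (zcomp g i).

Definition tinj (i : int) (t : tcomp i) : tens U V := [ffun k => zinj g i (t k)].

Definition tproj (i : int) (t : tens U V) : tcomp i :=
  [ffun k => zproj g i (t k)].

Fact tinj_is_linear i : linear (@tinj i).
Proof. by move=> a s t; apply/ffunP=> k; rewrite !ffunE linearP. Qed.

HB.instance Definition _ i :=
  GRing.isLinear.Build K (tcomp i) (tens U V) *:%R (@tinj i) (@tinj_is_linear i).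

Fact tproj_is_linear i : linear (@tproj i).
Proof. by move=> a s t; apply/ffunP=> k; rewrite !ffunE linearP. Qed.

HB.instance Definition _ i :=
  GRing.isLinear.Build K (tens U V) (tcomp i) *:%R (@tproj i) (@tproj_is_linear i).

Fact tinjK i (x : tcomp i) : tproj i (tinj x) = x.
Proof. by apply/ffunP=> k; rewrite !ffunE zinjK. Qed.

Fact tproj_neq i j (x : tcomp i) : i != j -> tproj j (tinj x) = 0.
Proof. by move=> ij; apply/ffunP=> k; rewrite !ffunE zproj_neq. Qed.

Fact tdecomp (t : tens U V) : exists2 s : seq int,
  uniq s & t = \sum_(i <- s) tinj (tproj i t).
Proof.
have wide (v : V) (s s' : seq int) : uniq s -> uniq s' -> {subset s <= s'} ->
    v = \sum_(i <- s) zinj g i (zproj g i v) ->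
    v = \sum_(i <- s') zinj g i (zproj g i v).
  move=> us us' ss' Ev.
  rewrite [LHS]Ev [RHS](bigID (mem s)) /= [X in _ = _ + X]big1.
    rewrite addr0 -[RHS]big_filter; apply: perm_big; apply: uniq_perm => //.
      exact: filter_uniq.
    by move=> i; rewrite mem_filter; case: (boolP (i \in s)) => // /ss' ->.
  move=> i si; suff -> : zproj g i v = 0 by rewrite linear0.
  rewrite Ev linear_sum big_seq big1 // => j js.
  by rewrite zproj_neq //; apply: contraNneq si => <-.
have /choice [s sP] : forall k, exists s : seq int,
    uniq s /\ t k = \sum_(i <- s) zinj g i (zproj g i (t k)).
  by move=> k; have [s us Es] := zdecomp g (t k); exists s; split.
exists (undup (flatten [seq s k | k : 'I_(\dim {:U}%VS)])).
  exact: undup_uniq.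
apply/ffunP=> k; rewrite sum_ffunE.
under eq_bigr do rewrite !ffunE.
apply: wide (sP k).2; rewrite ?undup_uniq ?(sP k).1 // => i ik.
by rewrite mem_undup; apply/flatten_mapP; exists k; rewrite ?mem_enum.
Qed.

(* [U ⊗ V = ⊕_i U ⊗ V_i], with [U] in degree 0. *)
Definition tens_zgrading : zgrading (tens U V) :=
  ZGrading (zinj := fun i => @tinj i) (zproj := fun i => @tproj i)
    tinjK tproj_neq tdecomp.

End TensorGrading.

Record leibnizDendriform (K : fieldType) := LeibnizDendriform {
  ld_sort :> vectType K;
  ld_succ : {bilinear ld_sort -> ld_sort -> ld_sort};
  ld_prec : {bilinear ld_sort -> ld_sort -> ld_sort};
  ld_circ := fun x y => ld_succ x y + ld_prec x y;
  ld_axiom1 : forall x y z, ld_succ (ld_circ x y) z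
    = ld_succ x (ld_succ y z) - ld_succ y (ld_succ x z);
  ld_axiom2 : forall x y z, ld_prec y (ld_circ x z) + ld_prec (ld_succ x y) z
    = ld_succ x (ld_prec y z);
  ld_axiom3 : forall x y z, ld_prec x (ld_circ y z)
    = ld_prec (ld_prec x y) z + ld_succ y (ld_prec x z)
}.

Notation "x '≻' y" := (ld_succ _ x y) (at level 38, left associativity).
Notation "x '≺' y" := (ld_prec _ x y) (at level 38, left associativity).
Notation "x '∘' y" := (ld_circ x y) (at level 38, left associativity).

Definition ld_odot (K : fieldType) (A : leibnizDendriform K) (x y : A) : A :=
  x ≻ y + y ≺ x.

Notation "x '⊙' y" := (ld_odot x y) (at level 38, left associativity).

Record quadZinbiel (K : fieldType) := QuadZinbiel {
  qz_sort :> lmodType K;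
  qz_grading : zgrading qz_sort;
  qz_mul : {bilinear qz_sort -> qz_sort -> qz_sort};
  qz_form : {biscalar qz_sort};
  qz_mul_graded : forall i j x y, exists z,
    qz_mul (zinj qz_grading i x) (zinj qz_grading j y)
      = zinj qz_grading (i + j) z;
  qz_zinbiel : forall x y z,
    qz_mul x (qz_mul y z) = qz_mul (qz_mul x y) z + qz_mul (qz_mul y x) z;
  qz_nondegenerate : forall x, (forall y, qz_form x y = 0) -> x = 0;
  qz_skew : forall x y, qz_form x y = - qz_form y x;
  qz_invariant : forall x y z,
    qz_form (qz_mul x y) z = qz_form y (qz_mul x z + qz_mul z x);
  qz_form_graded : exists m : int, forall i j x y, i + j + m != 0 ->
    qz_form (zinj qz_grading i x) (zinj qz_grading j y) = 0
}.

Notation "x '⋄' y" := (qz_mul _ x y) (at level 38, left associativity).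

Record zgradedPreLie (K : fieldType) := ZGradedPreLie {
  pl_sort :> lmodType K;
  pl_grading : zgrading pl_sort;
  pl_mul : {bilinear pl_sort -> pl_sort -> pl_sort};
  pl_mul_graded : forall i j x y, exists z,
    pl_mul (zinj pl_grading i x) (zinj pl_grading j y)
      = zinj pl_grading (i + j) z;
  pl_axiom : forall x y z,
    pl_mul (pl_mul x y) z - pl_mul x (pl_mul y z)
      = pl_mul (pl_mul y x) z - pl_mul y (pl_mul x z)
}.

Notation "x '·' y" := (pl_mul _ x y) (at level 38, left associativity).

Definition pl_bracket (K : fieldType) (L : zgradedPreLie K) (x y : L) : L :=
  x · y - y · x.

Definition homogeneous_basis (K : fieldType) (V : lmodType K) (g : zgrading V)
    (Omega : choiceType) (e : Omega -> V) : Prop :=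
  [/\ forall j, homogeneous g (e j),
      forall (s : seq Omega) (c : Omega -> K), uniq s ->
        \sum_(j <- s) c j *: e j = 0 -> forall j, j \in s -> c j = 0
    & forall v, exists (s : seq Omega) (c : Omega -> K),
        v = \sum_(j <- s) c j *: e j].

Definition homogeneous_dual_basis (K : fieldType) (B : quadZinbiel K)
    (Omega : choiceType) (e f : Omega -> B) : Prop :=
  homogeneous_basis (qz_grading B) f /\
  forall i j, qz_form B (e i) (f j) = (i == j)%:R.

Section TensorPreLie.
Context {K : fieldType} (A : leibnizDendriform K) (B : quadZinbiel K).

Definition tens_mul (s t : tens A B) : tens A B :=
  tlift (fun a x => tlift (fun b y =>
    (a ≻ b) ⊗ (x ⋄ y) - (b ≺ a) ⊗ (y ⋄ x)) t) s.

Let beta (a : A) (x : B) (b : A) (y : B) : tens A B :=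
  (a ≻ b) ⊗ (x ⋄ y) - (b ≺ a) ⊗ (y ⋄ x).

Let beta_bilinearr a x : bilinear_for *:%R *:%R (beta a x).
Proof.
split=> [y c b b' | b c y y']; rewrite /beta !(linearPl, linearPr) /=.
  by rewrite scalerBr opprD addrACA.
by rewrite scalerBr opprD addrACA.
Qed.

Let tens_mul_linearr s : linear (tens_mul s).
Proof.
move=> c t t'; rewrite /tens_mul /tlift scaler_sumr -big_split /=.
apply: eq_bigr => k _.
exact: (tlift_is_linear (beta_bilinearr _ _).2).
Qed.

Let tlift_bilinear t :
  bilinear_for *:%R *:%R (fun a x => tlift (beta a x) t).
Proof.
split=> [x c a a' | a c x x'] /=; rewrite /tlift scaler_sumr -big_split /=;
  apply: eq_bigr => k _; rewrite /beta !(linearPl, linearPr) /=;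
  by rewrite scalerBr opprD addrACA.
Qed.

Fact tens_mul_bilinear : bilinear_for *:%R *:%R tens_mul.
Proof.
split=> [t|s]; last exact: tens_mul_linearr.
exact: (tlift_is_linear (tlift_bilinear t).2).
Qed.

HB.instance Definition _ :=
  bilinear_isBilinear.Build K _ _ _ _ _ tens_mul tens_mul_bilinear.

Lemma tens_mulE a x b y : tens_mul (a ⊗ x) (b ⊗ y)
  = (a ≻ b) ⊗ (x ⋄ y) - (b ≺ a) ⊗ (y ⋄ x).
Proof.
rewrite /tens_mul (tlift_pure _ _ (tlift_bilinear _)).
exact: (tlift_pure _ _ (beta_bilinearr a x)).
Qed.

Fact tens_mul_graded i j x y : exists z,
  tens_mul (zinj (tens_zgrading A (qz_grading B)) i x)
           (zinj (tens_zgrading A (qz_grading B)) j y)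
    = zinj (tens_zgrading A (qz_grading B)) (i + j) z.
Proof.
pose P (t : tens A B) := exists z,
  t = zinj (tens_zgrading A (qz_grading B)) (i + j) z.
have PD s t : P s -> P t -> P (s + t).
  by move=> [s' ->] [t' ->]; exists (s' + t'); rewrite linearD.
have Ppure a (i' j' : int) x' y' : i' + j' = i + j ->
    P (a ⊗ (zinj (qz_grading B) i' x' ⋄ zinj (qz_grading B) j' y')).
  move=> ij; have [z Ez] := qz_mul_graded x' y'.
  have [z' ->] : exists z', qz_mul B (zinj _ i' x') (zinj _ j' y')
      = zinj (qz_grading B) (i + j) z' by rewrite -ij; exists z.
  by exists (a ⊗ z'); apply/ffunP=> k; rewrite !ffunE linearZ.
have P0 : P 0 by exists 0; rewrite linear0.
rewrite -/(P _) /tens_mul /tlift.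
elim/big_ind: _ => // k _; elim/big_ind: _ => // l _; rewrite !ffunE -linearNl.
by apply: PD; apply: Ppure; rewrite // addrC.
Qed.

Let tens_assoc a x b y c z :
  tens_mul (tens_mul (a ⊗ x) (b ⊗ y)) (c ⊗ z)
    - tens_mul (a ⊗ x) (tens_mul (b ⊗ y) (c ⊗ z))
  = ((a ≻ b) ≻ c - a ≻ (b ≻ c)) ⊗ ((x ⋄ y) ⋄ z)
  + (- ((b ≺ a) ≻ c) - a ≻ (b ≻ c)) ⊗ ((y ⋄ x) ⋄ z)
  + (a ≻ (c ≺ b) - c ≺ (a ≻ b)) ⊗ ((z ⋄ x) ⋄ y)
  + (a ≻ (c ≺ b) - c ≺ (a ≻ b)) ⊗ ((x ⋄ z) ⋄ y)
  + (c ≺ (b ≺ a) - (c ≺ b) ≺ a) ⊗ ((z ⋄ y) ⋄ x)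
  + (c ≺ (b ≺ a) + (b ≻ c) ≺ a) ⊗ ((y ⋄ z) ⋄ x).
Proof.
rewrite !tens_mulE !(linearBl, linearBr) /= !tens_mulE !qz_zinbiel.
rewrite !(linearDl, linearBl, linearNl, linearDr) /= !opprD !opprK !addrA.
by rewrite [LHS](ACl (1*7*4*8*11*2*10*3*5*12*6*9)).
Qed.

Fact tens_mul_prelie x y z :
  tens_mul (tens_mul x y) z - tens_mul x (tens_mul y z)
    = tens_mul (tens_mul y x) z - tens_mul y (tens_mul x z).
Proof.
move: x y z; apply: tens_ind => [|s s' IHs IHs'|a x] y z.
- by rewrite !(linear0l, linear0r).
- rewrite !(linearDl, linearDr) /=.
  by rewrite !opprD addrACA IHs IHs' addrACA.
move: y z; apply: tens_ind => [|s s' IHs IHs'|b y] z.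
- by rewrite !(linear0l, linear0r).
- rewrite !(linearDl, linearDr) /=.
  by rewrite !opprD addrACA IHs IHs' addrACA.
move: z; apply: tens_ind => [|s s' IHs IHs'|c z].
- by rewrite !(linear0l, linear0r).
- rewrite !(linearDl, linearDr) /=.
  by rewrite !opprD addrACA IHs IHs' addrACA.
have succ1 p q : (p ≻ q) ≻ c - p ≻ (q ≻ c) = - ((p ≺ q) ≻ c) - q ≻ (p ≻ c).
  have /eqP := ld_axiom1 p q c; rewrite linearDl /= => /eqP E.
  by rewrite -[(p ≻ q) ≻ c](addrK ((p ≺ q) ≻ c)) E [LHS](ACl (1*4*2*3)) /=
    subrr add0r addrC.
have prec1 p q : p ≻ (c ≺ q) - c ≺ (p ≻ q) = c ≺ (p ≺ q) - (c ≺ p) ≺ q.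
  have := ld_axiom3 c p q; rewrite /ld_circ linearDr /= addrC => E.
  by apply/eqP; rewrite subr_eq addrAC E [_ + p ≻ _]addrC addrK.
have prec2 p q : p ≻ (c ≺ q) - c ≺ (p ≻ q) = c ≺ (p ≺ q) + (p ≻ c) ≺ q.
  by rewrite -ld_axiom2 /ld_circ linearDr /= addrAC [X in X - _]addrC addrK.
rewrite !tens_assoc [RHS](ACl (2*1*5*6*3*4)) /=.
by rewrite (succ1 a) -(succ1 b) -!prec1 -!prec2.
Qed.

Definition tens_preLie : zgradedPreLie K :=
  ZGradedPreLie (pl_mul := tens_mul) tens_mul_graded tens_mul_prelie.

End TensorPreLie.

Definition LDYBE (K : fieldType) (A : leibnizDendriform K) (r : tens A A) :
    Prop :=
  tlift (fun u v => tlift (fun u' v' =>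
    u' ⊗ (u ⊗ (v ∘ v')) - u ⊗ ((v ⊙ u') ⊗ v') - (u ≻ u') ⊗ (v ⊗ v')) r) r
  = 0 :> tens A (tens A A).

Definition ld_invariant (K : fieldType) (A : leibnizDendriform K)
    (s : tens A A) : Prop :=
  forall x : A,
    tmap (fun a => x ⊙ a) id s - tmap id (fun a => a ∘ x) s = 0 /\
    tmap (fun a => x ∘ a + a ∘ x) id (tflip s)
      - tmap id (fun a => a ≺ x) (tflip s) = 0.

(** An element of a product of finite-dimensional spaces [T d] is a family; a
    formal sum [\sum_i F i] of such elements makes sense when it is finite in
    each [T d]; [csum] is the value in that case ([\sum_(i \in _)] is [0] on
    an infinite support). *)

Definition csummable (K : fieldType) (J : Type) (T : J -> vectType K)
    (I : choiceType) (F : I -> forall d, T d) : Prop :=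
  forall d, finite_set [set i | F i d <> 0].

Definition csum (K : fieldType) (J : Type) (T : J -> vectType K)
    (I : choiceType) (F : I -> forall d, T d) : forall d, T d :=
  fun d => \sum_(i \in [set: I]) F i d.

Section Completed.
Context {K : fieldType} (L : zgradedPreLie K).

Local Notation inj := (zinj (pl_grading L)).
Local Notation proj := (zproj (pl_grading L)).

Definition ctens2_comp (d : int * int) : vectType K :=
  tens (zcomp (pl_grading L) d.1) (zcomp (pl_grading L) d.2).

Definition ctens3_comp (d : int * int * int) : vectType K :=
  tens (zcomp (pl_grading L) d.1.1)
    (tens (zcomp (pl_grading L) d.1.2) (zcomp (pl_grading L) d.2)).

Definition ctens2 := forall d, ctens2_comp d.
Definition ctens3 := forall d, ctens3_comp d.

Definition cpure2 (a b : L) : ctens2 := fun d => proj d.1 a ⊗ proj d.2 b.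

Definition cpure3 (a b c : L) : ctens3 :=
  fun d => proj d.1.1 a ⊗ (proj d.1.2 b ⊗ proj d.2 c).

Definition csub (s t : ctens2) : ctens2 := fun d => s d - t d.

Definition cflip (s : ctens2) : ctens2 := fun d => tflip (s (d.2, d.1)).

(* The terms of [(phi ⊗^ psi) s], indexed by the bidegrees in [s]. *)
Definition cmap_terms (phi psi : L -> L) (s : ctens2) (d : int * int) :
    ctens2 :=
  fun p => tlift (fun a b => cpure2 (phi (inj _ a)) (psi (inj _ b)) p) (s d).

(* The terms of [\sum_(i,j) gamma a_i b_i a_j b_j] for [r = \sum_i a_i ⊗ b_i],
   indexed by pairs of bidegrees in [r]. *)
Definition cquad_terms (gamma : L -> L -> L -> L -> ctens3) (r : ctens2)
    (d : (int * int) * (int * int)) : ctens3 :=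
  fun p => tlift (fun a b => tlift (fun a' b' =>
    gamma (inj _ a) (inj _ b) (inj _ a') (inj _ b') p) (r d.2)) (r d.1).

Definition r12_r13_terms :=
  cquad_terms (fun a b a' b' => cpure3 (a · a') b b').
Definition r12_r23_terms :=
  cquad_terms (fun a b a' b' => cpure3 a (b · a') b').
Definition r13_r23_terms :=
  cquad_terms (fun a b a' b' => cpure3 a a' (pl_bracket b b')).

(* For a general [r] the three operations need not be defined, as they involve
   infinite sums in each component: their existence is part of the notion. *)
Definition completed_S_solution (r : ctens2) : Prop :=
  [/\ csummable (r12_r13_terms r), csummable (r12_r23_terms r),
      csummable (r13_r23_terms r)
    & forall d, csum (r12_r13_terms r) d - csum (r12_r23_terms r) d
                  - csum (r13_r23_terms r) d = 0].

Definition cinvariant (s : ctens2) : Prop :=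
  forall x : L,
    [/\ csummable (cmap_terms (fun a => x · a) id s),
        csummable (cmap_terms id (fun b => x · b - b · x) s)
      & forall d, csum (cmap_terms (fun a => x · a) id s) d
                  + csum (cmap_terms id (fun b => x · b - b · x) s) d = 0].

Definition csymmetric (s : ctens2) : Prop := forall d, cflip s d = s d.

End Completed.

(* The terms of [\sum_i \sum_j (u_i ⊗ e_j) ⊗ (v_i ⊗ f_j)]. *)
Definition rhat_terms (K : fieldType) (A : leibnizDendriform K)
    (B : quadZinbiel K) (Omega : choiceType) (e f : Omega -> B) (n : nat)
    (u v : 'I_n -> A) (k : 'I_n * Omega) : ctens2 (tens_preLie A B) :=
  cpure2 (L := tens_preLie A B) (u k.1 ⊗ e k.2) (v k.1 ⊗ f k.2).

Definition rhat (K : fieldType) (A : leibnizDendriform K)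
    (B : quadZinbiel K) (Omega : choiceType) (e f : Omega -> B) (n : nat)
    (u v : 'I_n -> A) : ctens2 (tens_preLie A B) :=
  csum (rhat_terms e f u v).

(* Main.v *)
(** The bilinear form identifies test vectors on [B] with the two legs of the
    canonical element [\sum_j e_j ⊗ f_j]: contracting its second leg with
    [omega(-, y)] gives [- y], contracting its first leg gives [y].  An element
    of a completed tensor power of [A ⊗ B] vanishes as soon as all its values
    under the functionals [alpha ⊗ omega(-, y)] do.  Under such functionals the
    three terms of the S-equation become scalar double sums over [r ⊗ r], each
    weighted by a value of [omega(x ⋄ y, z)] with permuted arguments.  Invariance
    and skewness reduce these weights to [P = omega(x ⋄ y, z)] and
    [Q = omega(y ⋄ x, z)].  The coefficient of [Q] is the LD-YBE for [r]; that of
    [P] is the LD-YBE with the first two tensor factors exchanged, corrected by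
    a term that the invariance of [r + tau r] kills.  The invariance of
    [r^ - tau r^] is the same computation with one factor less. *)

From HB Require Import structures.
Require Import Defs.
From mathcomp Require Import all_boot all_order all_algebra.
From mathcomp Require Import boolp classical_sets functions cardinality fsbigop.
From mathcomp Require Import ring.

Set Implicit Arguments.
Unset Strict Implicit.
Unset Printing Implicit Defensive.

Import GRing.Theory.
Local Open Scope ring_scope.

(** * Linear functionals on tensor products and separating families *)

Section Tensors.
Context {K : fieldType} {U V : vectType K} {M N : lmodType K}.

Lemma tlift0 (W : lmodType K) (beta : U -> M -> W) :
  (forall u, beta u 0 = 0) -> tlift beta 0 = 0.
Proof. by move=> b0; apply: big1 => k _; rewrite ffunE. Qed.

Lemma tlift_eq0 (W : lmodType K) (beta : U -> M -> W) t :
  (forall u v, beta u v = 0) -> tlift beta t = 0.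
Proof. by move=> b0; apply: big1 => k _. Qed.

Lemma eq_tlift (W : lmodType K) (beta beta' : U -> M -> W) t :
  beta =2 beta' -> tlift beta t = tlift beta' t.
Proof. by move=> bb'; apply: eq_bigr => k _. Qed.

Lemma linear_tlift (W W' : lmodType K) (h : {linear W -> W'})
    (beta : U -> M -> W) t :
  h (tlift beta t) = tlift (fun u v => h (beta u v)) t.
Proof. exact: linear_sum. Qed.

Lemma tliftD (W : lmodType K) (beta : U -> M -> W) s t :
  bilinear_for *:%R *:%R beta -> tlift beta (s + t) = tlift beta s + tlift beta t.
Proof. by case=> _ lin; have := tlift_is_linear lin 1 s t; rewrite !scale1r. Qed.

Lemma tlift_sum_pure (W : lmodType K) (beta : U -> M -> W) (I : Type)
    (s : seq I) (u : I -> U) (v : I -> M) :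
  bilinear_for *:%R *:%R beta ->
  tlift beta (\sum_(i <- s) u i ⊗ v i) = \sum_(i <- s) beta (u i) (v i).
Proof.
move=> bil; elim: s => [|i s IH].
  rewrite !big_nil tlift0 // => w.
  by have := bil.2 w (-1) 0 0; rewrite /= !scaleN1r !addNr.
by rewrite !big_cons tliftD // tlift_pure // IH.
Qed.

(** The functional [f ⊗ g]; scalars are taken as the regular module [K^o] so that the result is
    again a linear map and can be nested. *)
Definition tpair (f : U -> K^o) (g : M -> K^o) (t : tens U M) : K^o :=
  tlift (fun u v => f u *: g v) t.

Fact tpair_is_linear (f : U -> K^o) (g : {linear M -> K^o}) :
  linear (tpair f g).
Proof.
apply: tlift_is_linear => u c v v'.
by rewrite linearP scalerDr !scalerA mulrC.
Qed.

HB.instance Definition _ (f : U -> K^o) (g : {linear M -> K^o}) :=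
  GRing.isLinear.Build K (tens U M) K^o *:%R (tpair f g) (tpair_is_linear f g).

Lemma tpairE (f : {linear U -> K^o}) (g : {linear M -> K^o}) u v :
  tpair f g (u ⊗ v) = (f u : K) * (g v : K) :> K.
Proof.
rewrite /tpair tlift_pure //; split=> [w c x y|w c x y] /=.
  by rewrite linearP scalerDl scalerA.
by rewrite linearP scalerDr !scalerA mulrC.
Qed.

Definition separating (P : {linear M -> K^o} -> Prop) :=
  forall x, (forall f, P f -> f x = 0) -> x = 0.

End Tensors.

(** Contracting the second leg of [t] with [g] leaves the vector with coordinates [g (t k)]. The
    functionals in [P] force it to vanish, freeness of the basis makes each [g (t k)] zero, and then
    [Q] forces each [t k] to vanish. *)
Lemma tens_eq0_separating {K : fieldType} {U : vectType K} {M : lmodType K}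
    (P : {linear U -> K^o} -> Prop) (Q : {linear M -> K^o} -> Prop) t :
  separating P -> separating Q ->
  (forall f g, P f -> Q g -> tpair f g t = 0) -> t = 0.
Proof.
move=> sepP sepQ t0; apply/ffunP=> k; rewrite ffunE; apply: sepQ => g Qg.
have : \sum_(k < \dim {:U}%VS) g (t k) *: (vbasis {:U}%VS)`_k = 0.
  apply: sepP => f Pf; rewrite linear_sum -[RHS](t0 f g Pf Qg).
  by apply: eq_bigr => l _; rewrite linearZ; exact: mulrC.
by have /freeP fr := basis_free (vbasisP {:U}%VS); move/(fr (fun l => g (t l))).
Qed.

Lemma coord_separating {K : fieldType} {U : vectType K} :
  separating (fun f : {linear U -> K^o} => True).
Proof.
move=> u u0; rewrite (coord_vbasis (memvf u)) big1 // => k _.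
by rewrite (u0 (coord (vbasis {:U}%VS) k)) // scale0r.
Qed.

(** * The trilinear form [w (x ⋄ y) z] under permutation of its arguments *)

Section Form.
Context {K : fieldType} (B : quadZinbiel K).

Definition qform (y x : B) : K^o := qz_form B x y.

Fact qform_is_linear y : linear (qform y).
Proof. by move=> c x x'; rewrite /qform linearPl. Qed.

HB.instance Definition _ y :=
  GRing.isLinear.Build K B K^o *:%R (qform y) (qform_is_linear y).

Local Notation w := (qz_form B).

(** Invariance and skewness combine into [w (a ⋄ b) c + w (a ⋄ c) b + w (c ⋄ a) b = 0]. Its
    instances express the six permuted values through [w (x ⋄ y) z] and [w (y ⋄ x) z]. *)
Lemma qz_form_cyc x y z :
  [/\ w (x ⋄ z) y = - (w (x ⋄ y) z + w (y ⋄ x) z),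
      w (y ⋄ z) x = - (w (x ⋄ y) z + w (y ⋄ x) z),
      w (z ⋄ x) y = w (y ⋄ x) z & w (z ⋄ y) x = w (x ⋄ y) z].
Proof.
have inv a b c : w (a ⋄ b) c = - w (a ⋄ c) b - w (c ⋄ a) b.
  by rewrite qz_invariant qz_skew linearDl opprD.
have E1 := inv x z y; have E2 := inv y z x.
have E3 : w (z ⋄ x) y = - w (x ⋄ z) y - w (x ⋄ y) z.
  by rewrite (inv x y z); ring.
have E4 : w (z ⋄ y) x = - w (y ⋄ z) x - w (y ⋄ x) z.
  by rewrite (inv y x z); ring.
by split; rewrite ?E3 ?E4 ?E1 ?E2; ring.
Qed.

End Form.

(** * Expansions along dual bases, and their finiteness in each degree *)

Section DualBases.
Context {K : fieldType} {B : quadZinbiel K} {Omega : choiceType}.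
Variables (e f : Omega -> B).
Hypotheses (He : homogeneous_basis (qz_grading B) e)
  (Hf : homogeneous_dual_basis e f).
Local Notation w := (qz_form B).

Lemma sum_delta (J s : seq Omega) (c : Omega -> K) (h : Omega -> B) :
  uniq J -> {subset s <= J} ->
  \sum_(j <- J) (\sum_(i <- s) c i * (i == j)%:R) *: h j
    = \sum_(i <- s) c i *: h i.
Proof.
move=> uJ sJ; under eq_bigr do rewrite scaler_suml.
rewrite exchange_big /= big_seq [RHS]big_seq; apply: eq_bigr => i /sJ iJ.
rewrite (bigD1_seq i) //= eqxx mulr1 big1 ?addr0 // => j ji.
by rewrite eq_sym (negPf ji) mulr0 scale0r.
Qed.

(** The minus sign comes from pairing in the order [w (f j) b], opposite to the normalization
    [w (e i) (f j)]. Any larger list [J] is allowed, so that the expansion can share its index list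
    with a component of [rhat]. *)
Lemma dual_expansion_l (b : B) : exists S : seq Omega,
  forall J, uniq J -> {subset S <= J} ->
  \sum_(j <- J) w (f j) b *: e j = - b.
Proof.
have [_ _ /(_ b) [s [c Eb]]] := He; exists s => J uJ sJ.
rewrite {2}Eb -(sum_delta c e uJ sJ) -sumrN; apply: eq_bigr => j _.
rewrite qz_skew Eb linear_sumlz scaleNr; congr (- (_ *: _)).
by apply: eq_bigr => i _; rewrite linearZl_LR /= Hf.2.
Qed.

Lemma dual_expansion_r (b : B) : exists S : seq Omega,
  forall J, uniq J -> {subset S <= J} ->
  \sum_(j <- J) w (e j) b *: f j = b.
Proof.
have [[_ _ /(_ b) [s [c Eb]]] Hd] := Hf; exists s => J uJ sJ.
rewrite {2}Eb -(sum_delta c f uJ sJ); apply: eq_bigr => j _.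
rewrite Eb linear_sumr; congr (_ *: _).
by apply: eq_bigr => i _; rewrite linearZr_LR /= Hd eq_sym.
Qed.

(** Finitely many [e i] suffice to expand a basis of the finite-dimensional component of degree [p].
    An [e j] of degree [p] outside these would be a combination of other basis vectors, so it would
    pair to 0 with [f j] instead of 1. *)
Lemma basis_proj_neq0 (p : int) : exists S : seq Omega,
  forall j, zproj (qz_grading B) p (e j) <> 0 -> j \in S.
Proof.
have [he _ se] := He; set g := qz_grading B.
have /choice [s sP] : forall k : 'I_(\dim {: zcomp g p}), exists s : seq Omega,
    exists c, zinj g p (vbasis {: zcomp g p})`_k = \sum_(j <- s) c j *: e j.
  by move=> k; exact: se.
exists (flatten [seq s k | k : 'I_(\dim {: zcomp g p})]) => j.
have [i [x ej]] := he j; have [ip|ip] := eqVneq i p; last first.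
  by rewrite ej zproj_neq.
subst i => _; apply: contrapT => jS.
have := Hf.2 j j; rewrite eqxx {1}ej (coord_vbasis (memvf x)).
rewrite linear_sum linear_sumlz big1 => [/eqP|k _].
  by rewrite eq_sym oner_eq0.
have [c Ek] := sP k.
rewrite linearZ /= Ek linearZl_LR linear_sumlz big_seq big1 ?mulr0 // => i ik.
rewrite linearZl_LR /= Hf.2; case: eqP => [ij|]; last by rewrite mulr0.
by case: jS; apply/flatten_mapP; exists k; rewrite ?mem_enum // -ij.
Qed.

End DualBases.

(** * Test functionals in a fixed degree *)

Section Graded.
Context {K : fieldType} {A : leibnizDendriform K} {B : quadZinbiel K}.
Variable m : int.
Local Notation g := (qz_grading B).
Local Notation w := (qz_form B).
Local Notation G := (tens_zgrading A (qz_grading B)).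
Hypothesis mP : forall i j x y, i + j + m != 0 ->
  w (zinj g i x) (zinj g j y) = 0.

(** The form is graded, so a vector of degree [j] pairs to zero with every component of [b] of
    degree other than [- m - j], which is [i]. *)
Lemma qz_form_proj i j b y : i + j + m = 0 ->
  w (zinj g i (zproj g i b)) (zinj g j y) = w b (zinj g j y).
Proof.
move=> ij; have [s us Eb] := zdecomp g b.
rewrite [in RHS]Eb linear_sumlz; have [iS|iS] := boolP (i \in s).
  rewrite (bigD1_seq i) //= big1 ?addr0 // => k ki; apply: mP.
  by apply: contraNneq ki => kj; apply/eqP; move: kj; rewrite -ij => /addIr/addIr.
rewrite Eb linear_sum big_seq big1 => [|k ks]; last first.
  by rewrite zproj_neq //; apply: contraNneq iS => <-.
rewrite linear0 linear0l big_seq big1 // => k ks; apply: mP.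
by apply: contraNneq iS; rewrite -ij => /addIr/addIr <-.
Qed.

(* Test vectors are taken in degree [- m - p] so that the functional ignores the
   other components: see [ctest_proj]. *)
Definition ctest (p : int) (h : {linear tens A (zcomp g p) -> K^o}) :=
  exists (alpha : {linear A -> K^o}) y,
    h =1 tpair alpha (qform (zinj g (- m - p) y) \o zinj g p).

(** A vector of degree [p] pairs nontrivially only with degree [- m - p], so non-degeneracy on all
    of [B] already gives separation by test vectors of that degree. *)
Lemma ctest_separating p : separating (@ctest p).
Proof.
move=> t t0.
pose Q := fun h : {linear zcomp g p -> K^o} =>
  exists y, h =1 qform (zinj g (- m - p) y) \o zinj g p.
have sepQ : separating Q.
  move=> x x0; rewrite -(zinjK x).
  suff -> : zinj g p x = 0 by rewrite linear0.
  apply: (@qz_nondegenerate _ B) => y; have [s us ->] := zdecomp g y.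
  rewrite linear_sumr big1 // => i _.
  have [ip|ip] := eqVneq (p + i + m) 0; last exact: mP.
  have {ip} -> : i = - m - p by rewrite -[RHS]addr0 -ip; ring.
  by apply: (x0 (qform _ \o zinj g p)); exists (zproj g _ y).
apply: (tens_eq0_separating coord_separating sepQ) => alpha h _ [y Eh].
apply: t0; exists alpha, y => s; apply: eq_bigr => k _.
by rewrite Eh.
Qed.

Lemma ctest_proj alpha p j y t : p + j + m = 0 ->
  tpair alpha (qform (zinj g j y) \o zinj g p) (zproj G p t)
    = tpair alpha (qform (zinj g j y)) t :> K.
Proof.
move=> pj; apply: eq_bigr => k _; rewrite ffunE; congr (_ * _).
exact: qz_form_proj.
Qed.

End Graded.

(** * Summability, degree and contractions of [rhat] *)

Section Contraction.
Context {K : fieldType} {A : leibnizDendriform K} {B : quadZinbiel K}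
  {Omega : choiceType}.
Variables (e f : Omega -> B).
Hypotheses (He : homogeneous_basis (qz_grading B) e)
  (Hf : homogeneous_dual_basis e f).
Variables (n : nat) (u v : 'I_n -> A).
Local Notation g := (qz_grading B).
Local Notation w := (qz_form B).
Local Notation G := (tens_zgrading A (qz_grading B)).
Local Notation rh := (rhat e f u v).
Local Notation rht := (rhat_terms e f u v).

Lemma zproj_tpure p (a : A) x : zproj G p (a ⊗ x) = a ⊗ zproj g p x.
Proof. by apply/ffunP=> k; rewrite !ffunE linearZ. Qed.

Lemma zinj_tpure p (a : A) x : zinj G p (a ⊗ x) = a ⊗ zinj g p x.
Proof. by apply/ffunP=> k; rewrite !ffunE linearZ. Qed.

Lemma rhat_termsE i j d :
  rht (i, j) d = (u i ⊗ zproj g d.1 (e j)) ⊗ (v i ⊗ zproj g d.2 (f j)).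
Proof. by rewrite /rhat_terms /cpure2 /= !zproj_tpure. Qed.

Lemma rhat_terms_support d : exists S : seq Omega,
  forall k, rht k d <> 0 -> k.2 \in S.
Proof.
have [S HS] := basis_proj_neq0 He Hf d.1; exists S => -[i j] kd; apply: HS => ej.
by apply: kd; rewrite rhat_termsE ej linear0r linear0l.
Qed.

Lemma rhat_terms_summable : csummable rht.
Proof.
move=> d; have [S HS] := rhat_terms_support d.
apply: (@sub_finite_set _ _ [set` [seq (i, j) | i <- enum 'I_n, j <- S]]).
  move=> [i j] /HS jS; apply/allpairsP; exists (i, j) => /=.
  by rewrite mem_enum.
exact: finite_seq.
Qed.

(** Prescribing [S] lets the same list [J] carry both this component and a dual basis expansion. *)
Lemma rhat_sum d (S : seq Omega) : exists J : seq Omega,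
  [/\ uniq J, {subset S <= J} & rh d = \sum_(i < n) \sum_(j <- J) rht (i, j) d].
Proof.
have [S' HS] := rhat_terms_support d.
exists (undup (S ++ S')); split; first exact: undup_uniq.
  by move=> j jS; rewrite mem_undup mem_cat jS.
rewrite /rhat /csum (@fsbigE _ _ _ _ _ (allpairs pair (enum 'I_n) (undup (S ++ S')))).
- rewrite (eq_bigl xpredT); last by move=> k; rewrite in_setT.
  by rewrite big_allpairs big_enum.
- by apply: allpairs_uniq; rewrite ?enum_uniq ?undup_uniq // => -[? ?] [].
- by [].
move=> [i j] _ ij; apply: contrapT => /HS jS.
case/negP: ij; apply/allpairsP; exists (i, j); rewrite mem_enum.
by rewrite mem_undup mem_cat jS orbT.
Qed.

Variable m : int.
Hypothesis mP : forall i j x y, i + j + m != 0 ->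
  w (zinj g i x) (zinj g j y) = 0.

(** Since [w (e j) (f j)] is 1, the degrees of [e j] and [f j] add up to [- m]; hence [rhat] is
    concentrated in total degree [- m]. *)
Lemma rhat_eq0 d : d.1 + d.2 + m != 0 -> rh d = 0.
Proof.
move=> dm; have [J [_ _ ->]] := rhat_sum d [::].
rewrite big1 // => i _; rewrite big1 // => j _; rewrite rhat_termsE.
have [he _ _] := He; have [[hf _ _] Hd] := Hf.
have [p [x ej]] := he j; have [q [y fj]] := hf j.
rewrite ej; have [pd|pd] := eqVneq p d.1; last first.
  by rewrite zproj_neq // linear0r linear0l.
rewrite fj; have [qd|qd] := eqVneq q d.2; last first.
  by rewrite [zproj g d.2 _]zproj_neq // !linear0r.
have := Hd j j; rewrite eqxx ej fj mP ?pd ?qd // => /eqP.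
by rewrite eq_sym oner_eq0.
Qed.

Lemma rhat_contract_snd (h : {linear tens A B -> K^o})
    (beta : {linear A -> K^o}) q (y : zcomp g (- m - q)) (p := - m - q) :
  tpair (h \o zinj G p) (tpair beta (qform (zinj g p y)) \o zinj G q) (rh (p, q))
    = - \sum_(i < n) h (u i ⊗ zinj g p y) * beta (v i) :> K.
Proof.
have pq : p + q + m = 0 by rewrite /p; ring.
have [S HS] := dual_expansion_l He Hf (zinj g p y).
have [J [uJ SJ ->]] := rhat_sum (p, q) S.
rewrite linear_sum -sumrN; apply: eq_bigr => i _; rewrite linear_sum.
(* The component [(p, q)] contains only the degree-[p] part of each [e j]. Projecting the full
   expansion of [- y] is harmless, as [y] already has degree [p]. *)
transitivity (h (u i ⊗ zinj g p (zproj g p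
   (\sum_(j <- J) w (f j) (zinj g p y) *: e j))) * beta (v i)); last first.
  by rewrite HS // !linearN /= zinjK linearNr linearN mulNr.
rewrite !linear_sum linear_sumr linear_sum mulr_suml.
apply: eq_bigr => j _; rewrite rhat_termsE.
etransitivity; first exact: tpairE.
rewrite /= !zinj_tpure tpairE /=.
rewrite /qform (qz_form_proj mP); last by rewrite -pq [p + q]addrC.
by rewrite !linearZ /= linearZr_LR linearZ -mulrA [RHS]mulrC; ring.
Qed.

Lemma rhat_contract_fst (h : {linear tens A B -> K^o})
    (alpha : {linear A -> K^o}) p (x : zcomp g (- m - p)) (q := - m - p) :
  tpair (tpair alpha (qform (zinj g q x)) \o zinj G p) (h \o zinj G q) (rh (p, q))
    = \sum_(i < n) alpha (u i) * h (v i ⊗ zinj g q x) :> K.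
Proof.
have pq : p + q + m = 0 by rewrite /q; ring.
have [S HS] := dual_expansion_r Hf (zinj g q x).
have [J [uJ SJ ->]] := rhat_sum (p, q) S.
rewrite linear_sum; apply: eq_bigr => i _; rewrite linear_sum.
transitivity (alpha (u i) * h (v i ⊗ zinj g q (zproj g q
   (\sum_(j <- J) w (e j) (zinj g q x) *: f j)))); last first.
  by rewrite HS // zinjK.
rewrite !linear_sum linear_sumr linear_sum mulr_sumr.
apply: eq_bigr => j _; rewrite rhat_termsE.
etransitivity; first exact: tpairE.
rewrite /= !zinj_tpure tpairE /=.
rewrite /qform (qz_form_proj mP) // !linearZ /= linearZr_LR linearZ /=.
exact/esym/mulrA.
Qed.

End Contraction.

(** * Elements concentrated in one total degree: each infinite sum has at most one nonzero term per
    component *)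

Section Concentrated.
Context {K : fieldType} (L : zgradedPreLie K) (m : int) (r : ctens2 L).
Hypothesis r0 : forall d, d.1 + d.2 + m != 0 -> r d = 0.
Local Notation inj := (zinj (pl_grading L)).

Lemma degree_eq0_fst (p q : int) : (p + q + m == 0) = (p == - m - q).
Proof. by rewrite -[RHS]subr_eq0; congr (_ == 0); ring. Qed.

Lemma degree_eq0_snd (p q : int) : (p + q + m == 0) = (q == - m - p).
Proof. by rewrite -[RHS]subr_eq0; congr (_ == 0); ring. Qed.

Lemma csum_single (J : Type) (T : J -> vectType K) (I : choiceType)
    (F : I -> forall d, T d) d i0 :
  (forall i, i != i0 -> F i d = 0) ->
  finite_set [set i | F i d <> 0]%classic /\ csum F d = F i0 d.
Proof.
move=> F0; split.
  apply: (@sub_finite_set _ _ [set i0]%classic); last exact: finite_set1.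
  by move=> i /= Fi; apply: contrapT => /eqP /F0.
rewrite /csum; rewrite -[RHS](@fsbig_set1 _ 0 +%R _ i0 (F ^~ d)).
apply/esym/fsbig_widen => //.
by move=> i [_ /eqP] /F0.
Qed.

Lemma pl_proj_inj_neq p q (x : zcomp (pl_grading L) p) :
  q != p -> zproj (pl_grading L) q (inj p x) = 0.
Proof. by move=> qp; rewrite zproj_neq // eq_sym. Qed.

(* As [r] lives in total degree [- m], only these pairs of bidegrees of [r] contribute
   to the component [p] of the three terms of the S-equation. *)
Definition deg12_13 (p : int * int * int) :=
  ((- m - p.1.2, p.1.2), (- m - p.2, p.2)).
Definition deg12_23 (p : int * int * int) :=
  ((p.1.1, - m - p.1.1), (- m - p.2, p.2)).
Definition deg13_23 (p : int * int * int) :=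
  ((p.1.1, - m - p.1.1), (p.1.2, - m - p.1.2)).

(** A tensor is stored as the family of its right-hand coefficients, so a zero tensor enters as a
    zero second leg: the second or fourth argument of [gamma]. *)
Lemma cquad_terms_degree gamma d p :
  (forall a b a', gamma a b a' 0 p = 0) -> (forall a a' b', gamma a 0 a' b' p = 0) ->
  (d.1.1 + d.1.2 + m != 0) || (d.2.1 + d.2.2 + m != 0) ->
  cquad_terms gamma r d p = 0.
Proof.
move=> g4 g2 /orP[] d0; rewrite /cquad_terms (r0 d0).
  by apply: tlift0 => a; apply: tlift_eq0 => a' b'; rewrite linear0 g2.
by apply: tlift_eq0 => a b; apply: tlift0 => a'; rewrite linear0 g4.
Qed.

(** The second legs of both copies of [r] survive unmultiplied, so their degrees are read off from
    [p]; concentration then fixes the degrees of the first legs. In the next two lemmas the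
    untouched legs are the outer two, respectively both first legs. *)
Lemma r12_r13_eq0 d p : d != deg12_13 p -> r12_r13_terms r d p = 0.
Proof.
case: d => -[d1 d2] [d3 d4]; rewrite /deg12_13 !xpair_eqE /= => dp.
have [E2|/pl_proj_inj_neq E2] := eqVneq p.1.2 d2; last first.
  apply: tlift_eq0 => a b; apply: tlift_eq0 => a' b'.
  by rewrite /cpure3 E2 linear0l linear0r.
have [E4|/pl_proj_inj_neq E4] := eqVneq p.2 d4; last first.
  apply: tlift_eq0 => a b; apply: tlift_eq0 => a' b'.
  by rewrite /cpure3 E4 !linear0r.
apply: cquad_terms_degree => [a b a'|a a' b'|/=].
- by rewrite /cpure3 linear0 !linear0r.
- by rewrite /cpure3 linear0 linear0l !linear0r.
by move: dp; rewrite E2 E4 !eqxx !andbT negb_and !degree_eq0_fst.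
Qed.

Lemma r12_r23_eq0 d p : d != deg12_23 p -> r12_r23_terms r d p = 0.
Proof.
case: d => -[d1 d2] [d3 d4]; rewrite /deg12_23 !xpair_eqE /= => dp.
have [E1|/pl_proj_inj_neq E1] := eqVneq p.1.1 d1; last first.
  apply: tlift_eq0 => a b; apply: tlift_eq0 => a' b'.
  by rewrite /cpure3 E1 linear0l.
have [E4|/pl_proj_inj_neq E4] := eqVneq p.2 d4; last first.
  apply: tlift_eq0 => a b; apply: tlift_eq0 => a' b'.
  by rewrite /cpure3 E4 !linear0r.
apply: cquad_terms_degree => [a b a'|a a' b'|/=].
- by rewrite /cpure3 linear0 !linear0r.
- by rewrite /cpure3 linear0l linear0 linear0l !linear0r.
by move: dp; rewrite E1 E4 !eqxx !andbT negb_and degree_eq0_snd degree_eq0_fst.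
Qed.

Lemma r13_r23_eq0 d p : d != deg13_23 p -> r13_r23_terms r d p = 0.
Proof.
case: d => -[d1 d2] [d3 d4]; rewrite /deg13_23 !xpair_eqE /= => dp.
have [E1|/pl_proj_inj_neq E1] := eqVneq p.1.1 d1; last first.
  apply: tlift_eq0 => a b; apply: tlift_eq0 => a' b'.
  by rewrite /cpure3 E1 linear0l.
have [E3|/pl_proj_inj_neq E3] := eqVneq p.1.2 d3; last first.
  apply: tlift_eq0 => a b; apply: tlift_eq0 => a' b'.
  by rewrite /cpure3 E3 linear0l linear0r.
apply: cquad_terms_degree => [a b a'|a a' b'|/=].
- by rewrite /cpure3 /pl_bracket linear0l linear0r subrr linear0 !linear0r.
- by rewrite /cpure3 /pl_bracket linear0l linear0r subrr linear0 !linear0r.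
by move: dp; rewrite E1 E3 !eqxx /= negb_and !degree_eq0_snd.
Qed.

Lemma concentrated_S_solution :
  (forall p, r12_r13_terms r (deg12_13 p) p - r12_r23_terms r (deg12_23 p) p
               - r13_r23_terms r (deg13_23 p) p = 0) ->
  completed_S_solution r.
Proof.
move=> S0.
have s1 p := csum_single (fun d => @r12_r13_eq0 d p).
have s2 p := csum_single (fun d => @r12_r23_eq0 d p).
have s3 p := csum_single (fun d => @r13_r23_eq0 d p).
split=> p; try by case: (s1 p). by case: (s2 p). by case: (s3 p).
by rewrite (s1 p).2 (s2 p).2 (s3 p).2.
Qed.

Lemma concentrated_cinvariant :
  (forall x p, cmap_terms (fun a => x · a) id r (- m - p.2, p.2) p
     + cmap_terms id (fun b => x · b - b · x) r (p.1, - m - p.1) p = 0) ->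
  cinvariant r.
Proof.
move=> I0 x.
(* Multiplication by [x] on one leg leaves the degree of the other leg visible in [p], and
   concentration determines the remaining degree; [c2] is the mirror case. *)
have c1 d p : d != (- m - p.2, p.2) -> cmap_terms (fun a => x · a) id r d p = 0.
  case: d => d1 d2; rewrite xpair_eqE => dp.
  have [E2|/pl_proj_inj_neq E2] := eqVneq p.2 d2; last first.
    by apply: tlift_eq0 => a b; rewrite /cpure2 E2 linear0r.
  rewrite /cmap_terms r0; last first.
    by rewrite /= degree_eq0_fst -E2; rewrite E2 eqxx andbT -E2 in dp.
  by apply: tlift0 => a; rewrite /cpure2 /= !linear0 linear0r.
have c2 d p : d != (p.1, - m - p.1) ->
    cmap_terms id (fun b => x · b - b · x) r d p = 0.
  case: d => d1 d2; rewrite xpair_eqE => dp.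
  have [E1|/pl_proj_inj_neq E1] := eqVneq p.1 d1; last first.
    by apply: tlift_eq0 => a b; rewrite /cpure2 E1 linear0l.
  rewrite /cmap_terms r0; last first.
    by rewrite /= degree_eq0_snd -E1; rewrite E1 eqxx -E1 in dp.
  apply: tlift0 => a; rewrite /cpure2 linear0 linear0l.
  by rewrite linear0r subrr linear0 linear0r.
split=> p.
- by case: (csum_single (fun d => c1 d p)).
- by case: (csum_single (fun d => c2 d p)).
by rewrite (csum_single (fun d => c1 d p)).2 (csum_single (fun d => c2 d p)).2.
Qed.

End Concentrated.

(** * Scalar values of the three terms of the S-equation *)

Section Main.
Context {K : fieldType} {A : leibnizDendriform K} {B : quadZinbiel K}
  {Omega : choiceType}.
Variables (e f : Omega -> B).
Hypotheses (He : homogeneous_basis (qz_grading B) e)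
  (Hf : homogeneous_dual_basis e f).
Variables (n : nat) (u v : 'I_n -> A).
Local Notation g := (qz_grading B).
Local Notation w := (qz_form B).
Local Notation G := (tens_zgrading A (qz_grading B)).
Local Notation rh := (rhat e f u v).
Local Notation L := (tens_preLie A B).
Variable m : int.
Hypothesis mP : forall i j x y, i + j + m != 0 ->
  w (zinj g i x) (zinj g j y) = 0.

Local Notation lam alpha y := (tpair alpha (qform y)).
Local Notation tst alpha p y :=
  (tpair alpha (qform (zinj g (- m - p) y) \o zinj g p)).

Lemma cpure3_test (alpha beta gamma : {linear A -> K^o})
    (p : int * int * int) x y z (a b c : L) :
  tpair (tst alpha p.1.1 x) (tpair (tst beta p.1.2 y) (tst gamma p.2 z))
    (cpure3 a b c p)
  = lam alpha (zinj g _ x) a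
    * (lam beta (zinj g _ y) b * lam gamma (zinj g _ z) c) :> K.
Proof.
rewrite /cpure3 tpairE /= !tpairE /=.
have pm (q : int) : q + (- m - q) + m = 0 by ring.
by congr (_ * (_ * _)); apply: (ctest_proj mP); rewrite pm.
Qed.

(** Both copies of [rhat] are contracted on their second legs, and the two minus signs cancel. In
    [r12_r23_test] one contraction is on a first leg, so a sign remains; in [r13_r23_test] both
    are. *)
Lemma r12_r13_test (alpha beta gamma : {linear A -> K^o})
    (p : int * int * int) x y z :
  tpair (tst alpha p.1.1 x) (tpair (tst beta p.1.2 y) (tst gamma p.2 z))
    (r12_r13_terms rh (deg12_13 m p) p)
  = \sum_i \sum_k lam alpha (zinj g _ x)
      (tens_mul (u i ⊗ zinj g _ y) (u k ⊗ zinj g _ z))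
      * (beta (v i) * gamma (v k)) :> K.
Proof.
rewrite linear_tlift.
(* The second copy of [rhat] is contracted first, with the legs [a] and [b] of the first copy held
   fixed; [h a] is the functional applied to its other leg. *)
pose h a : {linear tens A B -> K^o} := lam alpha (zinj g _ x) \o pl_mul L a.
transitivity (tlift (fun a b => \sum_k gamma (v k)
    * - (h (zinj G _ a) (u k ⊗ zinj g _ z)
         * lam beta (zinj g _ y) (zinj G _ b)) : K^o)
  (rh (- m - p.1.2, p.1.2))).
  apply: eq_bigr => l _; rewrite linear_tlift.
  set a := (vbasis _)`_l; set b := rh _ l.
  transitivity (lam beta (zinj g _ y) (zinj G _ b)
    * tpair (h (zinj G _ a) \o zinj G _) (lam gamma (zinj g _ z) \o zinj G _)
        (rh (- m - p.2, p.2))).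
    rewrite [RHS]mulr_sumr; apply: eq_bigr => l' _.
    etransitivity; first exact: cpure3_test.
    by rewrite mulrCA.
  rewrite (rhat_contract_snd He Hf u v mP).
  by rewrite mulrN mulr_sumr -sumrN; apply: eq_bigr => k _; ring.
rewrite /tlift exchange_big [RHS]exchange_big; apply: eq_bigr => k _ /=.
(* The second copy has been reduced to [u k ⊗ z], so what acts on the first copy is right
   multiplication by this fixed vector. *)
pose h' : {linear tens A B -> K^o} :=
  lam alpha (zinj g _ x) \o applyr (pl_mul L) (u k ⊗ zinj g _ z).
transitivity (- gamma (v k)
  * tpair (h' \o zinj G _) (lam beta (zinj g _ y) \o zinj G _)
      (rh (- m - p.1.2, p.1.2))).
  by rewrite [RHS]mulr_sumr; apply: eq_bigr => l _; rewrite mulNr mulrN.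
rewrite (rhat_contract_snd He Hf u v mP).
rewrite mulNr mulrN opprK mulr_sumr; apply: eq_bigr => i _ /=.
by rewrite /h' /=; ring.
Qed.

Lemma r12_r23_test (alpha beta gamma : {linear A -> K^o})
    (p : int * int * int) x y z :
  tpair (tst alpha p.1.1 x) (tpair (tst beta p.1.2 y) (tst gamma p.2 z))
    (r12_r23_terms rh (deg12_23 m p) p)
  = - \sum_i \sum_k alpha (u i) * (lam beta (zinj g _ y)
      (tens_mul (v i ⊗ zinj g _ x) (u k ⊗ zinj g _ z)) * gamma (v k)) :> K.
Proof.
rewrite linear_tlift.
pose h b : {linear tens A B -> K^o} := lam beta (zinj g _ y) \o pl_mul L b.
transitivity (tlift (fun a b => \sum_k gamma (v k)
    * - (lam alpha (zinj g _ x) (zinj G _ a)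
         * h (zinj G _ b) (u k ⊗ zinj g _ z)) : K^o)
  (rh (p.1.1, - m - p.1.1))).
  apply: eq_bigr => l _; rewrite linear_tlift.
  set a := (vbasis _)`_l; set b := rh _ l.
  transitivity (lam alpha (zinj g _ x) (zinj G _ a)
    * tpair (h (zinj G _ b) \o zinj G _) (lam gamma (zinj g _ z) \o zinj G _)
        (rh (- m - p.2, p.2))).
    rewrite [RHS]mulr_sumr; apply: eq_bigr => l' _.
    exact: cpure3_test.
  rewrite (rhat_contract_snd He Hf u v mP).
  by rewrite mulrN mulr_sumr -sumrN; apply: eq_bigr => k _; ring.
rewrite /tlift exchange_big [in RHS]exchange_big -sumrN; apply: eq_bigr => k _ /=.
pose h' : {linear tens A B -> K^o} :=
  lam beta (zinj g _ y) \o applyr (pl_mul L) (u k ⊗ zinj g _ z).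
transitivity (- gamma (v k)
  * tpair (lam alpha (zinj g _ x) \o zinj G _) (h' \o zinj G _)
      (rh (p.1.1, - m - p.1.1))).
  by rewrite [RHS]mulr_sumr; apply: eq_bigr => l _; rewrite mulNr mulrN.
rewrite (rhat_contract_fst He Hf u v mP).
rewrite mulNr mulr_sumr; congr (- _); apply: eq_bigr => i _ /=.
by rewrite /h' /=; ring.
Qed.

Lemma r13_r23_test (alpha beta gamma : {linear A -> K^o})
    (p : int * int * int) x y z :
  tpair (tst alpha p.1.1 x) (tpair (tst beta p.1.2 y) (tst gamma p.2 z))
    (r13_r23_terms rh (deg13_23 m p) p)
  = \sum_i \sum_k alpha (u i) * (beta (u k) * lam gamma (zinj g _ z)
      (tens_mul (v i ⊗ zinj g _ x) (v k ⊗ zinj g _ y)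
         - tens_mul (v k ⊗ zinj g _ y) (v i ⊗ zinj g _ x))) :> K.
Proof.
rewrite linear_tlift.
pose h b : {linear tens A B -> K^o} :=
  lam gamma (zinj g _ z) \o (pl_mul L b \- applyr (pl_mul L) b).
transitivity (tlift (fun a b => \sum_k beta (u k)
    * (lam alpha (zinj g _ x) (zinj G _ a)
       * h (zinj G _ b) (v k ⊗ zinj g _ y)) : K^o)
  (rh (p.1.1, - m - p.1.1))).
  apply: eq_bigr => l _; rewrite linear_tlift.
  set a := (vbasis _)`_l; set b := rh _ l.
  transitivity (lam alpha (zinj g _ x) (zinj G _ a)
    * tpair (lam beta (zinj g _ y) \o zinj G _) (h (zinj G _ b) \o zinj G _)
        (rh (p.1.2, - m - p.1.2))).
    rewrite [RHS]mulr_sumr; apply: eq_bigr => l' _.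
    exact: cpure3_test.
  rewrite (rhat_contract_fst He Hf u v mP).
  by rewrite mulr_sumr; apply: eq_bigr => k _; ring.
rewrite /tlift exchange_big [RHS]exchange_big; apply: eq_bigr => k _ /=.
pose h' : {linear tens A B -> K^o} := lam gamma (zinj g _ z) \o
  (applyr (pl_mul L) (v k ⊗ zinj g _ y) \- pl_mul L (v k ⊗ zinj g _ y)).
transitivity (beta (u k)
  * tpair (lam alpha (zinj g _ x) \o zinj G _) (h' \o zinj G _)
      (rh (p.1.1, - m - p.1.1))).
  by rewrite [RHS]mulr_sumr; apply: eq_bigr => l _.
rewrite (rhat_contract_fst He Hf u v mP).
rewrite mulr_sumr; apply: eq_bigr => i _ /=.
by rewrite /h' /=; ring.
Qed.

Lemma lam_mul (alpha : {linear A -> K^o}) a b (x y z : B) :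
  lam alpha z (tens_mul (a ⊗ x) (b ⊗ y))
  = (alpha (a ≻ b) : K) * w (x ⋄ y) z - (alpha (b ≺ a) : K) * w (y ⋄ x) z :> K.
Proof. by rewrite tens_mulE linearB /= !tpairE. Qed.

(** The triple tensor product is nested, so the separating criterion is used twice: the products of
    two tests form the separating family for the last two factors. *)
Lemma tens3_test (p : int * int * int) (t : ctens3_comp L p) :
  (forall (alpha beta gamma : {linear A -> K^o}) x y z,
    tpair (tst alpha p.1.1 x) (tpair (tst beta p.1.2 y) (tst gamma p.2 z)) t
      = 0 :> K) -> t = 0.
Proof.
move=> t0.
apply: (tens_eq0_separating (ctest_separating mP (p := p.1.1)) (Q := fun h => exists h1 h2,
  [/\ ctest m h1, ctest m h2 & h =1 @tpair K _ _ h1 h2])).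
  move=> s s0; apply: (tens_eq0_separating (ctest_separating mP (p := p.1.2))
    (ctest_separating mP (p := p.2))).
  by move=> h1 h2 c1 c2; apply: s0; exists h1, h2.
move=> h h' [alpha [x Eh]] [h1 [h2 [[beta [y Eh1]] [gamma [z Eh2]] Eh']]].
rewrite -[RHS](t0 alpha beta gamma x y z); apply: eq_bigr => k _.
rewrite Eh Eh'; congr (_ *: _); apply: eq_bigr => l _.
by rewrite Eh1 Eh2.
Qed.

Lemma tens2_test (p : int * int) (t : ctens2_comp L p) :
  (forall (alpha beta : {linear A -> K^o}) x y,
    tpair (tst alpha p.1 x) (tst beta p.2 y) t = 0 :> K) -> t = 0.
Proof.
move=> t0; apply: (tens_eq0_separating (ctest_separating mP (p := p.1))
  (ctest_separating mP (p := p.2))).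
move=> h1 h2 [beta [y Eh1]] [gamma [z Eh2]]; rewrite -[RHS](t0 beta gamma y z).
by apply: eq_bigr => l _; rewrite Eh1 Eh2.
Qed.

End Main.

(** * The LD-YBE and the invariance of [r + tau r] as scalar identities *)

Section Scalar.
Context {K : fieldType} {A : leibnizDendriform K} {n : nat}.
Variables (u v : 'I_n -> A).
Implicit Types (alpha beta gamma : {linear A -> K^o}).
Local Notation r := (\sum_(i < n) u i ⊗ v i).

Lemma tpair_tflip {U V : vectType K} (f : {linear U -> K^o})
    (g : {linear V -> K^o}) (t : tens V U) :
  tpair f g (tflip t) = tpair g f t.
Proof.
rewrite linear_tlift; apply: eq_bigr => k _.
by rewrite /= tpairE; apply: mulrC.
Qed.

Lemma tflip_sum : tflip r = \sum_(i < n) v i ⊗ u i :> tens A A.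
Proof.
rewrite /tflip tlift_sum_pure //; split=> [x c a a'|x c a a'] /=.
  by rewrite linearPr.
by rewrite linearPl.
Qed.

(* The casts to [K] make these products those of [K], not of [K^o]. *)
Lemma LDYBE_scalar alpha beta gamma : LDYBE r ->
  \sum_i \sum_k (alpha (u k) : K) * ((beta (u i) : K) * (gamma (v i ∘ v k) : K))
  = \sum_i \sum_k (alpha (u i) : K) * ((beta (v i ⊙ u k) : K) * (gamma (v k) : K))
    + \sum_i \sum_k (alpha (u i ≻ u k) : K) * ((beta (v i) : K) * (gamma (v k) : K)).
Proof.
move=> /(congr1 (tpair alpha (tpair beta gamma))); rewrite linear0 linear_tlift.
pose F a b a' b' : K^o := (alpha a' : K) * ((beta a : K) * (gamma (b ∘ b') : K))
  - (alpha a : K) * ((beta (b ⊙ a') : K) * (gamma b' : K))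
  - (alpha (a ≻ a') : K) * ((beta b : K) * (gamma b' : K)).
have F1 a b : bilinear_for *:%R *:%R (F a b).
  split=> [b' c x x'|a' c x x']; rewrite /F /ld_circ /ld_odot /=.
    rewrite !(linearPl, linearPr, linearP, linearD) /=.
    by rewrite /GRing.scale /=; ring.
  rewrite !(linearPl, linearPr, linearP, linearD) /=.
  by rewrite /GRing.scale /=; ring.
have F2 a' b' : bilinear_for *:%R *:%R (fun a b => F a b a' b').
  split=> [b c x x'|a c x x']; rewrite /F /ld_circ /ld_odot /=.
    rewrite !(linearPl, linearPr, linearP, linearD) /=.
    by rewrite /GRing.scale /=; ring.
  rewrite !(linearPl, linearPr, linearP, linearD) /=.
  by rewrite /GRing.scale /=; ring.
have -> : tlift (fun a b => tpair alpha (tpair beta gamma) (tlift (fun a' b' =>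
    a' ⊗ (a ⊗ (b ∘ b')) - a ⊗ ((b ⊙ a') ⊗ b') - (a ≻ a') ⊗ (b ⊗ b')) r)) r
  = tlift (fun a b => \sum_k F a b (u k) (v k)) r.
  apply: eq_tlift => a b; rewrite linear_tlift.
  rewrite -(tlift_sum_pure _ _ _ (F1 a b)); apply: eq_tlift => a' b'.
  by rewrite !linearB /= !tpairE /= !tpairE.
rewrite tlift_sum_pure; last first.
  split=> [b c x x'|a c x x'] /=; rewrite scaler_sumr -big_split;
  apply: eq_bigr => k _.
    exact: (F2 _ _).1.
  exact: (F2 _ _).2.
move=> F0; apply/eqP; rewrite -subr_eq0 -[X in _ == X]F0 opprD addrA; apply/eqP.
rewrite -!sumrB; apply: eq_bigr => i _; rewrite -!sumrB.
by apply: eq_bigr.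
Qed.

Lemma sym_scalar (F : A -> A -> K^o) : bilinear_for *:%R *:%R F ->
  tlift F (r + tflip r) = \sum_i (F (u i) (v i) + F (v i) (u i)).
Proof.
move=> bil; by rewrite tflip_sum tliftD // !tlift_sum_pure // big_split.
Qed.

(** Allows the half of invariance that is stated for the flipped tensor to be read on [r + tau r]
    itself. *)
Lemma tflip_sym : tflip (r + tflip r) = r + tflip r.
Proof.
have bil : bilinear_for *:%R *:%R (fun a b : A => b ⊗ a).
  by split=> [x c a a'|x c a a'] /=; rewrite (linearPr, linearPl).
by rewrite tflip_sum /tflip tliftD // !tlift_sum_pure // addrC.
Qed.

Lemma invariant_scalar (phi psi phi' psi' : {linear A -> A}) alpha beta :
  tmap phi psi (r + tflip r) - tmap phi' psi' (r + tflip r) = 0 ->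
  \sum_i ((alpha (phi (u i)) : K) * (beta (psi (v i)) : K)
     + (alpha (phi (v i)) : K) * (beta (psi (u i)) : K)
     - (alpha (phi' (u i)) : K) * (beta (psi' (v i)) : K)
     - (alpha (phi' (v i)) : K) * (beta (psi' (u i)) : K)) = 0.
Proof.
pose F (f g : {linear A -> A}) a b : K^o := (alpha (f a) : K) * (beta (g b) : K).
have bF f g : bilinear_for *:%R *:%R (F f g).
  by split=> [b c x x'|a c x x']; rewrite /F /= !linearP /= /GRing.scale /=; ring.
have tF (f g : {linear A -> A}) t : tpair alpha beta (tmap f g t) = tlift (F f g) t.
  by rewrite linear_tlift; apply: eq_tlift => a b; rewrite /= tpairE.
move=> /(congr1 (tpair alpha beta)); rewrite linear0 linearB /= !tF.
rewrite !sym_scalar // -sumrB => E0; rewrite -[RHS]E0; apply: eq_bigr => i _.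
by rewrite /F; ring.
Qed.

Lemma invariant_odot alpha beta x : ld_invariant (r + tflip r) ->
  \sum_i ((alpha (x ≻ u i + u i ≺ x) : K) * (beta (v i) : K)
     + (alpha (x ≻ v i + v i ≺ x) : K) * (beta (u i) : K)
     - (alpha (u i) : K) * (beta (v i ≻ x + v i ≺ x) : K)
     - (alpha (v i) : K) * (beta (u i ≻ x + u i ≺ x) : K)) = 0.
Proof.
case/(_ x) => inv _.
exact: (@invariant_scalar (ld_succ A x \+ applyr (ld_prec A) x) idfun idfun
  (applyr (ld_succ A) x \+ applyr (ld_prec A) x)).
Qed.

Lemma invariant_star alpha beta x : ld_invariant (r + tflip r) ->
  \sum_i (
     (alpha (x ≻ u i + x ≺ u i + (u i ≻ x + u i ≺ x)) : K) * (beta (v i) : K)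
     + (alpha (x ≻ v i + x ≺ v i + (v i ≻ x + v i ≺ x)) : K) * (beta (u i) : K)
     - (alpha (u i) : K) * (beta (v i ≺ x) : K)
     - (alpha (v i) : K) * (beta (u i ≺ x) : K)) = 0.
Proof.
case/(_ x) => _; rewrite tflip_sym => inv.
exact: (@invariant_scalar (ld_succ A x \+ ld_prec A x
    \+ (applyr (ld_succ A) x \+ applyr (ld_prec A) x)) idfun idfun
  (applyr (ld_prec A) x)).
Qed.

(* [(R_≻ + L_≺) ⊗ I + I ⊗ R_≻] annihilates [r + tau r]. *)
Lemma invariant_succ_r alpha beta x : ld_invariant (r + tflip r) ->
  \sum_i ((alpha (u i ≻ x) + alpha (x ≺ u i) : K) * (beta (v i) : K)
     + (alpha (v i ≻ x) + alpha (x ≺ v i) : K) * (beta (u i) : K)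
     + (alpha (u i) : K) * (beta (v i ≻ x) : K)
     + (alpha (v i) : K) * (beta (u i ≻ x) : K)) = 0.
Proof.
move=> inv; have star0 := invariant_star alpha beta x inv.
have := congr2 (fun c d => c - d) star0 (invariant_odot alpha beta x inv).
rewrite /= subrr -sumrB => E0; rewrite -[RHS]E0; apply: eq_bigr => i _.
by rewrite !linearD /=; ring.
Qed.

(* [L_≻ ⊗ I + I ⊗ L_∘] annihilates [r + tau r]. *)
Lemma invariant_succ_l alpha beta x : ld_invariant (r + tflip r) ->
  \sum_i ((alpha (x ≻ u i) : K) * (beta (v i) : K)
     + (alpha (x ≻ v i) : K) * (beta (u i) : K)
     + (alpha (u i) : K) * (beta (x ≻ v i) + beta (x ≺ v i) : K)
     + (alpha (v i) : K) * (beta (x ≻ u i) + beta (x ≺ u i) : K)) = 0.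
Proof.
(* The two functionals are exchanged, so that the right multiplications by [x] in this identity
   cancel those of [invariant_odot] on opposite legs. *)
move=> inv; have star0 := invariant_star beta alpha x inv.
have := congr2 +%R star0 (invariant_odot alpha beta x inv).
rewrite addr0 -big_split /= => E0; rewrite -[RHS]E0; apply: eq_bigr => i _.
by rewrite !linearD /=; ring.
Qed.

End Scalar.

(** * The S-equation, invariance and symmetry for [rhat] *)

Section Solution.
Context {K : fieldType} {A : leibnizDendriform K} {B : quadZinbiel K}
  {Omega : choiceType}.
Variables (e f : Omega -> B).
Hypotheses (He : homogeneous_basis (qz_grading B) e)
  (Hf : homogeneous_dual_basis e f).
Variables (n : nat) (u v : 'I_n -> A).
Local Notation g := (qz_grading B).
Local Notation w := (qz_form B).
Local Notation G := (tens_zgrading A (qz_grading B)).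
Local Notation rh := (rhat e f u v).
Local Notation L := (tens_preLie A B).
Local Notation r := (\sum_(i < n) u i ⊗ v i).
Local Notation lam alpha y := (tpair alpha (qform y)).
Local Notation tst m alpha p y :=
  (tpair alpha (qform (zinj g (- m - p) y) \o zinj g p)).

Lemma dsum_combination (c d : K) (F1 F2 F : 'I_n -> 'I_n -> K) :
  (forall i k, F i k = c * F1 i k - d * F2 i k) ->
  \sum_i \sum_k F i k = c * (\sum_i \sum_k F1 i k) - d * (\sum_i \sum_k F2 i k).
Proof.
move=> EF; rewrite !mulr_sumr -sumrB; apply: eq_bigr => i _.
by rewrite !mulr_sumr -sumrB; apply: eq_bigr => k _.
Qed.

Lemma rhat_S_solution : LDYBE r -> ld_invariant (r + tflip r) ->
  completed_S_solution rh.
Proof.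
move=> ybe inv; have [m mP] := qz_form_graded B.
apply: (concentrated_S_solution (rhat_eq0 He Hf u v mP)) => p.
apply: (tens3_test mP) => alpha beta gamma x y z.
rewrite !linearB /= (r12_r13_test He Hf u v mP) (r12_r23_test He Hf u v mP).
rewrite (r13_r23_test He Hf u v mP).
move: (zinj g _ x) (zinj g _ y) (zinj g _ z) => {}x {}y {}z.
have [w1 w2 w3 w4] := qz_form_cyc x y z.
pose P := w (x ⋄ y) z; pose Q := w (y ⋄ x) z.
pose F1 i k := (alpha (u i ≻ u k) : K) * ((beta (v i) : K) * (gamma (v k) : K)).
pose F2 i k := (alpha (u k ≺ u i) : K) * ((beta (v i) : K) * (gamma (v k) : K)).
pose F3 i k := (alpha (u i) : K) * ((beta (v i ≻ u k) : K) * (gamma (v k) : K)).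
pose F4 i k := (alpha (u i) : K) * ((beta (u k ≺ v i) : K) * (gamma (v k) : K)).
pose F5 i k := (alpha (u i) : K) * ((beta (u k) : K) * (gamma (v i ∘ v k) : K)).
pose F6 i k := (alpha (u i) : K) * ((beta (u k) : K) * (gamma (v k ∘ v i) : K)).
rewrite (@dsum_combination (- (P + Q)) P F1 F2); last first.
  by move=> i k; rewrite lam_mul w2 w4 /F1 /F2 -/P -/Q; ring.
set S1 := \sum_i \sum_k F1 i k; set S2 := \sum_i \sum_k F2 i k.
rewrite (@dsum_combination (- (P + Q)) Q F3 F4); last first.
  by move=> i k; rewrite lam_mul w1 w3 /F3 /F4 -/P -/Q; ring.
set S3 := \sum_i \sum_k F3 i k; set S4 := \sum_i \sum_k F4 i k.
rewrite (@dsum_combination P Q F5 F6); last first.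
  by move=> i k; rewrite linearB /= !lam_mul -/P -/Q /F5 /F6 /ld_circ !linearD /=; ring.
set S5 := \sum_i \sum_k F5 i k; set S6 := \sum_i \sum_k F6 i k.
(* The expression is now [- P * (S1 + S2 + S3 + S5) + Q * (S6 - S1 - S3 - S4)]; [E6] and [E5] say
   that the two brackets vanish. *)
have E6 : S6 = S3 + S4 + S1.
  rewrite /S6 exchange_big (LDYBE_scalar alpha beta gamma ybe); congr (_ + _).
  rewrite /S3 /S4 -big_split; apply: eq_bigr => i _; rewrite -big_split.
  by apply: eq_bigr => k _; rewrite /F3 /F4 /ld_odot linearD /=; ring.
have E5 : S1 + S2 + S3 + S5 = 0.
  (* With [alpha] and [beta] exchanged, [S5] becomes the left side of the LD-YBE. After its
     expansion the sum over [i], for fixed [k], is [gamma (v k)] times [invariant_succ_r] at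
     [u k]. *)
  have -> : S5 = \sum_i \sum_k (beta (u k) : K)
      * ((alpha (u i) : K) * (gamma (v i ∘ v k) : K)).
    by apply: eq_bigr => i _; apply: eq_bigr => k _; rewrite mulrCA.
  rewrite (LDYBE_scalar beta alpha gamma ybe) /S1 /S2 /S3 -!big_split /=.
  under eq_bigr do rewrite -!big_split /=.
  rewrite exchange_big big1 // => k _.
  rewrite -[RHS](mulr0 (gamma (v k) : K))
    -[X in _ = _ * X](invariant_succ_r alpha beta (u k) inv).
  rewrite mulr_sumr; apply: eq_bigr => i _.
  by rewrite /F1 /F2 /F3 /ld_odot linearD /=; ring.
have {E5} -> : S5 = - S1 - S2 - S3 by rewrite -[LHS]subr0 -E5; ring.
by rewrite E6; ring.
Qed.

Local Notation s := (csub rh (cflip rh)).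

Section Sym.
Variable m : int.
Hypothesis mP : forall i j x y, i + j + m != 0 ->
  w (zinj g i x) (zinj g j y) = 0.

Lemma rhat_antisym_eq0 d : d.1 + d.2 + m != 0 -> s d = 0.
Proof.
move=> dm; rewrite /csub /cflip !(rhat_eq0 He Hf u v mP) //=.
  rewrite /tflip tlift0 ?subrr // => a; exact: linear0l.
by rewrite [d.2 + d.1]addrC.
Qed.

(** The flip turns the first-leg contraction into a second-leg one, which carries a minus sign. The
    difference of [rhat] and its flip therefore produces the sum [r + tau r] on the side of [A]. *)
Lemma antisym_contract_fst (h : {linear tens A B -> K^o})
    (alpha : {linear A -> K^o}) p (x : zcomp g (- m - p)) :
  tpair (lam alpha (zinj g _ x) \o zinj G p) (h \o zinj G _) (s (p, - m - p))
    = \sum_i ((alpha (u i) : K) * (h (v i ⊗ zinj g _ x) : K)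
        + (h (u i ⊗ zinj g _ x) : K) * (alpha (v i) : K)) :> K.
Proof.
rewrite /csub /cflip linearB /= tpair_tflip (rhat_contract_fst He Hf u v mP).
by rewrite (rhat_contract_snd He Hf u v mP) opprK -big_split.
Qed.

Lemma antisym_contract_snd (h : {linear tens A B -> K^o})
    (beta : {linear A -> K^o}) p (y : zcomp g (- m - p)) :
  tpair (h \o zinj G _) (lam beta (zinj g _ y) \o zinj G p) (s (- m - p, p))
    = - \sum_i ((h (u i ⊗ zinj g _ y) : K) * (beta (v i) : K)
        + (beta (u i) : K) * (h (v i ⊗ zinj g _ y) : K)) :> K.
Proof.
rewrite /csub /cflip linearB /= tpair_tflip (rhat_contract_fst He Hf u v mP).
by rewrite (rhat_contract_snd He Hf u v mP) big_split opprD.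
Qed.

Lemma cpure2_test (alpha beta : {linear A -> K^o}) (p : int * int) x y (a b : L) :
  tpair (tst m alpha p.1 x) (tst m beta p.2 y) (cpure2 a b p)
  = (lam alpha (zinj g _ x) a : K) * (lam beta (zinj g _ y) b : K) :> K.
Proof.
rewrite /cpure2 tpairE.
have pm (q : int) : q + (- m - q) + m = 0 by ring.
by congr (_ * _); apply: (ctest_proj mP); rewrite pm.
Qed.

End Sym.

Lemma tpair_zinj (alpha : A -> K^o) (h : B -> K^o) p (t : zcomp G p) :
  tpair alpha (h \o zinj g p) t = tpair alpha h (zinj G p t).
Proof. by apply: eq_bigr => k _; rewrite ffunE. Qed.

Lemma rhat_antisym_invariant : ld_invariant (r + tflip r) -> cinvariant s.
Proof.
move=> inv; have [m mP] := qz_form_graded B.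
apply: (concentrated_cinvariant (rhat_antisym_eq0 mP)) => X p.
apply: (tens2_test mP) => alpha beta x y.
rewrite linearD /=.
pose h1 : {linear tens A B -> K^o} := lam alpha (zinj g _ x) \o pl_mul L X.
pose h2 : {linear tens A B -> K^o} :=
  lam beta (zinj g _ y) \o (pl_mul L X \- applyr (pl_mul L) X).
have -> : tpair (tst m alpha p.1 x) (tst m beta p.2 y)
   (cmap_terms (fun a => pl_mul L X a) id s (- m - p.2, p.2) p)
  = tpair (h1 \o zinj G _) (lam beta (zinj g _ y) \o zinj G _) (s (- m - p.2, p.2)).
  by rewrite linear_tlift; apply: eq_bigr => k _; exact: (cpure2_test mP).
have -> : tpair (tst m alpha p.1 x) (tst m beta p.2 y)
   (cmap_terms id (fun b => pl_mul L X b - pl_mul L b X) s (p.1, - m - p.1) p)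
  = tpair (lam alpha (zinj g _ x) \o zinj G _) (h2 \o zinj G _) (s (p.1, - m - p.1)).
  by rewrite linear_tlift; apply: eq_bigr => k _; exact: (cpure2_test mP).
rewrite (antisym_contract_fst mP) (antisym_contract_snd mP) addrC -sumrB /= {h1 h2}.
move: (zinj g _ x) (zinj g _ y) X => {}x {}y.
apply: tens_ind => [|X X' IHX IHX'|c t].
- rewrite big1 // => i _.
  by rewrite !linear0l !linear0r subrr !linear0; ring.
- rewrite -[RHS]addr0 -[X in _ = X + _]IHX -[X in _ = _ + X]IHX' -big_split.
  apply: eq_bigr => i _ /=.
  by rewrite !linearB !linearDl !linearDr !linearD /=; ring.
have [w1 w2 w3 w4] := qz_form_cyc t x y.
(* Once the arguments of the form are permuted to these two values, their coefficients are exactly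
   [invariant_succ_l] and [invariant_odot] at [c]. *)
transitivity (w (t ⋄ x) y * 0 + w (x ⋄ t) y * 0); last by rewrite !mulr0 addr0.
rewrite -[X in _ = _ * X + _](invariant_succ_l alpha beta c inv).
rewrite -[X in _ = _ + _ * X](invariant_odot alpha beta c inv).
rewrite !mulr_sumr -big_split; apply: eq_bigr => i _.
rewrite !linearB /= !lam_mul w1 w3.
by rewrite !linearD /=; ring.
Qed.

Lemma rhat_symmetric : r + tflip r = 0 -> csymmetric rh.
Proof.
move=> r0 d; have [m mP] := qz_form_graded B.
apply/eqP; rewrite eq_sym -subr_eq0; apply/eqP; rewrite -[LHS]/(s d).
have [|/(rhat_antisym_eq0 mP)//] := eqVneq (d.1 + d.2 + m) 0.
(* Only bidegrees [(p, - m - p)] remain. There a test value of the difference is [w x y] times the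
   value of [alpha ⊗ beta] on [r + tau r], which is zero. *)
case: d => p q /= /eqP; rewrite degree_eq0_snd => /eqP ->.
apply: (tens2_test mP (p := (_, _))) => alpha beta x y.
transitivity (tpair (lam alpha (zinj g _ x) \o zinj G p)
    (lam beta (zinj g _ y) \o zinj G (- m - p)) (s (p, - m - p))).
  by apply: eq_bigr => k _; congr (_ * _); apply: tpair_zinj.
etransitivity; first exact: (antisym_contract_fst mP (lam beta (zinj g _ y)) alpha x).
have r0' : \sum_i ((alpha (u i) : K) * (beta (v i) : K)
    + (alpha (v i) : K) * (beta (u i) : K)) = 0.
  have := congr1 (tpair alpha beta) r0; rewrite tflip_sum linear0 linearD !linear_sum /=.
  move=> E0; rewrite -[RHS]E0 -big_split; apply: eq_bigr => i _.
  by rewrite !tpairE.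
rewrite -[RHS](mulr0 (w (zinj g _ x) (zinj g _ y))) -[X in _ = _ * X]r0' mulr_sumr.
by apply: eq_bigr => i _; rewrite /= !tpairE /= /qform; ring.
Qed.

End Solution.

Theorem theorem2p31 (K : fieldType) (A : leibnizDendriform K)
    (B : quadZinbiel K) (Omega : choiceType) (e f : Omega -> B)
    (He : homogeneous_basis (qz_grading B) e)
    (Hf : homogeneous_dual_basis e f)
    (n : nat) (u v : 'I_n -> A) (r : tens A A)
    (Hr : r = \sum_(i < n) u i ⊗ v i) :
  csummable (rhat_terms e f u v) /\
  (LDYBE r -> ld_invariant (r + tflip r) ->
     completed_S_solution (rhat e f u v) /\
     cinvariant (csub (rhat e f u v) (cflip (rhat e f u v)))) /\
  (LDYBE r -> tflip r = - r ->
     completed_S_solution (rhat e f u v) /\ csymmetric (rhat e f u v)).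
Proof.
rewrite {r}Hr; split; first exact: rhat_terms_summable.
split=> ybe => [inv|skew].
  by split; [exact: rhat_S_solution | exact: rhat_antisym_invariant].
(* For skew-symmetric [r] the tensor [r + tau r] is zero, hence invariant, so the S-equation is a
   case of the first claim. *)
have s0 : \sum_(i < n) u i ⊗ v i + tflip (\sum_(i < n) u i ⊗ v i) = 0 :> tens A A.
  by rewrite skew subrr.
split; last exact: rhat_symmetric.
apply: rhat_S_solution => // x; rewrite s0.
have tm0 (phi psi : A -> A) : psi 0 = 0 -> tmap phi psi (0 : tens A A) = 0.
  by move=> psi0; apply: tlift0 => a; rewrite psi0 linear0r.
have -> : tflip (0 : tens A A) = 0 by apply: tlift0 => a; exact: linear0l.
by rewrite !tm0 ?subrr // /ld_circ !linear0l ?addr0.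
Qed.
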